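(* For each $\alpha\in(0,1/2)$, $$\mathbb P\Big(\lim_{s\to\infty}s^{\alpha}\,\big|\mathscr R(s)-s\big|=0\Big)=1 .$$
   Context: Let $W$ be a standard one-dimensional Wiener process on a probability space $(\Omega,\mathcal F,\mathbb P)$ with $W(0)=0$, and let $\sigma>0$. For $s\ge 0$ and $x\in\mathbb R$, let $X_{s,t}(x)$, $t\ge s$, denote the unique local solution (defined pathwise, for almost every $\omega$, simultaneously for all $s,x$) of the stochastic differential equation $$dX(t)=X(t)\big(X(t)-t\big)\,dt+\sigma\,dW(t),\quad t\ge s,\qquad X(s)=x,$$ i.e. of $X(t)=x+\int_s^tX(u)(X(u)-u)\,du+\sigma(W(t)-W(s))$. The blow-up time is $\beta_s(x):=\lim_{n\to\infty}\inf\{t>s:\ |X_{s,t}(x)|\ge n\}\in(s,\infty]$. The random repelling river is $$\mathscr R(s)=\mathscr R(s,\omega):=\inf\{x\in\mathbb R:\ \beta_s(x)<\infty\}\in[-\infty,\infty),\qquad s\ge 0.$$ *)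

(* Defs.v *)
From HB Require Import structures.
From mathcomp Require Import all_boot all_order all_algebra.
From mathcomp Require Import all_classical all_reals all_analysis.
Set Implicit Arguments.
Unset Strict Implicit.
Unset Printing Implicit Defensive.
Import Order.TTheory GRing.Theory Num.Theory.
Import numFieldTopology.Exports numFieldNormedType.Exports.

Local Open Scope classical_set_scope.
Local Open Scope ring_scope.

(* Time is indexed by the whole of R, but only the times t >= 0 are
   constrained.  [normal_prob] takes a standard deviation, not a variance.
   In the third clause some of the [B i] may be [setT], so the product rule for
   the whole family includes the one for every subfamily. *)
Definition wiener_process {d : measure_display} {T : measurableType d}
    {R : realType} (P : probability T R) (W : R -> {RV P >-> R}) : Prop :=
  [/\ {ae P, forall w, W 0 w = 0},
      {ae P, forall w, {within `[0, +oo[, continuous (fun t : R => W t w)}},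
      forall (n : nat) (t : nat -> R) (B : nat -> set R),
        0 <= t 0%N -> (forall i, (i < n)%N -> t i <= t i.+1) ->
        (forall i, measurable (B i)) ->
        P [set w | forall i, (i < n)%N -> B i (W (t i.+1) w - W (t i) w)] =
        (\prod_(i < n) P [set w | B i (W (t i.+1) w - W (t i) w)%R])%E &
      forall (s t : R) (A : set R), 0 <= s -> s < t -> measurable A ->
        P [set w | A (W t w - W s w)] = normal_prob 0 (Num.sqrt (t - s)) A].

Section repelling_river.
Context {R : realType}.
Variables (sigma : R) (p : R -> R).
(* [p] is a fixed path of the driving noise. *)

Definition local_solution (s x t : R) (Y : R -> R) : Prop :=
  {within `[s, t], continuous Y} /\
  forall r, s <= r <= t ->
    Y r = x + \int[lebesgue_measure]_(u in `[s, r]) (Y u * (Y u - u))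
            + sigma * (p r - p s).

(* The graph of the partial function t |-> X_{s,t}(x): the local solution
   started from x at time s exists up to time t and its value there is y. *)
Definition flow (s x t y : R) : Prop :=
  s <= t /\ exists2 Y : R -> R, local_solution s x t Y & Y t = y.

Definition hitting_time (s x : R) (n : nat) : \bar R :=
  ereal_inf [set t%:E | t in
    [set t : R | s < t /\ exists2 y, flow s x t y & n%:R <= `|y| ]].

(* Hence the limit defining the blow-up time always exists in \bar R. *)
Lemma nondecreasing_hitting_time (s x : R) :
  {homo hitting_time s x : m n / (m <= n)%N >-> (m <= n)%E}.
Proof.
move=> m n mn; apply: ereal_inf_le_tmp => _ [t [st [y fy ny]] <-].
exists t => //; split => //; exists y => //.
by apply: le_trans ny; rewrite ler_nat.
Qed.

Definition blowup_time (s x : R) : \bar R :=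
  lim (hitting_time s x n @[n --> \oo]).

Definition river (s : R) : \bar R :=
  ereal_inf [set x%:E | x in [set x : R | (blowup_time s x < +oo)%E]].

End repelling_river.

(* Main.v *)
Require Import Defs.
From HB Require Import structures.
From mathcomp Require Import all_boot all_order all_algebra.
From mathcomp Require Import all_classical all_reals all_analysis.
From mathcomp Require Import measurable_realfun ring lra.
Import Order.TTheory GRing.Theory Num.Theory.
Import numFieldTopology.Exports numFieldNormedType.Exports.
Local Open Scope classical_set_scope.
Local Open Scope ring_scope.

(** Put U(t) = X(t) - t, so that dU = ((t + U) U - 1) dt + sigma dW: near the
    diagonal the drift repels U from 0 at rate t.

    Pathwise, suppose that for every c > 0 the noise oscillates by at most
    c s^-alpha on each window [s, s + 1/s] with s large.  If U(s) <= -d with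
    d = e s^-alpha, then over one window the repulsion gains d/4, which exceeds
    the oscillation, so that U stays below the negative barrier -e t^-alpha up
    to an oscillation and X never blows up.  If U(s) >= d, every window
    multiplies U by at least 19/16; hence U outgrows the barrier d (1 + t - s)^2,
    reaches 8 t, and then U' >= U^2 / 4 explodes within 1/t.  So
    |R(s) - s| <= d for all large s.

    Almost surely the noise has this property: by the Gaussian tail and
    Borel-Cantelli, eventually in n all dyadic increments of level n before
    time 2^(n+2) are at most q^n, for any q with q^2 > 1/2; chaining along
    dyadic approximations bounds the oscillation on [s, s + 1/s] by C q^n for
    2^n <= s < 2^(n+1), and 2^alpha q < 1 can be achieved since alpha < 1/2. *)

(** * Barriers for real functions *)

Section real_functions.
Context {R : realType}.
Implicit Types (f g : R -> R) (a b c : R).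

(** [Num.max a (Num.min x b)] is the projection of the line onto [a, b]. It extends functions
    continuous on [a, b] to all of R, and later truncates the quadratic drift. *)
Lemma clamp_itv a b x : a <= b -> a <= Num.max a (Num.min x b) <= b.
Proof. by move=> ab; rewrite le_max lexx /= ge_max ab ge_min lexx orbT. Qed.

Lemma clamp_id a b x : a <= x <= b -> Num.max a (Num.min x b) = x.
Proof. by move=> /andP[ax xb]; rewrite min_l// max_r. Qed.

Lemma continuous_clamp a b : continuous (fun x : R => Num.max a (Num.min x b)).
Proof.
apply: (@max_fun_continuous _ _ _ (cst a) (id \min cst b)).
  by move=> ?; exact: cvg_cst.
by apply: min_fun_continuous => ?; [exact: cvg_id|exact: cvg_cst].
Qed.

Lemma clamp_contract a b x y : a <= b ->
  `|Num.max a (Num.min x b) - Num.max a (Num.min y b)| <= `|x - y|.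
Proof.
wlog xy : x y / x <= y => [H ab|ab].
  by have [/H|/ltW/H] := leP x y; last rewrite distrC (distrC x); exact.
have -> : `|x - y| = y - x by rewrite distrC ger0_norm// subr_ge0.
rewrite ler_norml.
by case: (leP x b); case: (leP y b); case: (leP a x); case: (leP a y);
  case: (leP a b) => *; apply/andP; split; lra.
Qed.

Lemma continuous_comp_clamp f a b : a <= b -> {within `[a, b], continuous f} ->
  continuous (fun x => f (Num.max a (Num.min x b))).
Proof.
move=> ab /subspace_continuousP cf x.
have cI : `[a, b]%classic (Num.max a (Num.min x b)) by rewrite /= in_itv/= clamp_itv.
move=> B nB; have := continuous_clamp a b x _ (cf _ cI B nB).
apply: (@filterS _ (nbhs x)) => y; apply.
by rewrite /= in_itv/= clamp_itv.
Qed.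

Lemma closed_itv_ge f a b c : a <= b -> {within `[a, b], continuous f} ->
  closed [set r | a <= r <= b /\ c <= f r].
Proof.
move=> ab /(continuous_comp_clamp _ _ _ ab) cf.
rewrite (_ : [set _ | _] = `[a, b] `&`
    (fun x => f (Num.max a (Num.min x b))) @^-1` [set y | c <= y]); last first.
  apply/seteqP; split => r /=; rewrite in_itv/= => -[abr].
    by rewrite clamp_id.
  by rewrite clamp_id.
apply: closedI; first exact: itv_closed.
by apply: preimage_closed; [move=> ? _; exact: cf|exact: closed_ge].
Qed.

(** The superlevel set is closed, hence contains its supremum. The continuation arguments below
    start a new window at this last time and contradict its maximality. *)
Lemma last_time f a b c : a <= b -> {within `[a, b], continuous f} ->
  c <= f a -> exists tau, [/\ a <= tau <= b, c <= f tau &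
    forall r, tau < r <= b -> f r < c].
Proof.
move=> ab cf cfa; set S := [set r | a <= r <= b /\ c <= f r].
have Sa : S a by rewrite /S/= lexx ab.
have ubS : has_ubound S by exists b => r [/andP[]].
have [sab cs] : S (sup S).
  by apply: (closed_itv_ge _ _ _ c ab cf); apply: closure_sup => //; exists a.
exists (sup S); split => // r /andP[sr rb]; rewrite ltNge; apply/negP => cr.
have /(ub_le_sup ubS) : S r.
  by split => //; rewrite rb andbT (le_trans _ (ltW sr))//; case/andP: sab.
by rewrite leNgt sr.
Qed.

Lemma first_time f a b c : a <= b -> {within `[a, b], continuous f} ->
  c <= f b -> exists tau, [/\ a <= tau <= b, c <= f tau &
    forall r, a <= r < tau -> f r < c].
Proof.
move=> ab cf cfb.
have cg : {within `[- b, - a], continuous (f \o -%R)}.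
  by apply: within_continuous_compN; rewrite !opprK.
have cgb : c <= (f \o -%R) (- b) by rewrite /= opprK.
have [|tau [taub ctau H]] := last_time _ _ _ _ _ cg cgb; first by rewrite lerN2.
exists (- tau); split => //; first by rewrite lerNr lerNl andbC.
move=> r /andP[ar rt]; have := H (- r); rewrite /= opprK; apply.
by rewrite ltrNr rt lerN2.
Qed.

Lemma within_continuous_itvW f a b c d : a <= c -> d <= b ->
  {within `[a, b], continuous f} -> {within `[c, d], continuous f}.
Proof.
move=> ac db; apply: continuous_subspaceW; apply: subset_itv => //.
Qed.

Lemma within_continuousD f g (A : set R) : {within A, continuous f} ->
  {within A, continuous g} -> {within A, continuous (fun x => f x + g x)}.
Proof. by move=> cf cg x; apply: cvgD; [exact: cf|exact: cg]. Qed.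

Lemma within_continuousB f g (A : set R) : {within A, continuous f} ->
  {within A, continuous g} -> {within A, continuous (fun x => f x - g x)}.
Proof. by move=> cf cg x; apply: cvgB; [exact: cf|exact: cg]. Qed.

Lemma within_continuousM f g (A : set R) : {within A, continuous f} ->
  {within A, continuous g} -> {within A, continuous (fun x => f x * g x)}.
Proof. by move=> cf cg x; apply: cvgM; [exact: cf|exact: cg]. Qed.

Lemma within_continuousV f (A : set R) : {within A, continuous f} ->
  (forall x, A x -> f x != 0) -> {within A, continuous (fun x => (f x)^-1)}.
Proof.
move=> /subspace_continuousP cf f0; apply/subspace_continuousP => x Ax.
by apply: cvgV; [exact: f0|exact: cf].
Qed.

Lemma continuous_affine (k a : R) : continuous (fun x : R => k * (x - a)).
Proof.
move=> x; apply: cvgM; first exact: cvg_cst.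
by apply: cvgB; [exact: cvg_id|exact: cvg_cst].
Qed.

Lemma is_derive_affine (k a r : R) : is_derive r 1 (fun x : R => k * (x - a)) k.
Proof. by apply: is_derive_eq; rewrite subr0 [LHS]mulr1. Qed.

(** Pick a level e in ]c, c'[ that f would reach. Between the last time at which f is at most c and
    the first time at which it is e, f stays in the strip, so the mean value theorem forbids the
    climb. The sign of the derivative thus matters only just above the barrier. *)
Lemma barrier f df a b c c' : c < c' -> {within `[a, b], continuous f} ->
  (forall r, a < r < b -> is_derive r 1 f (df r)) ->
  (forall r, a < r < b -> c < f r < c' -> df r <= 0) ->
  f a <= c -> forall r, a <= r <= b -> f r <= c.
Proof.
move=> cc' cf dff fle fa r0 /andP[ar0 r0b]; rewrite leNgt; apply/negP => cr0.
pose e := Num.min (f r0) ((c + c') / 2).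
have ce : c < e by rewrite /e lt_min cr0 midf_lt.
have ec' : e < c' by rewrite /e gt_min midf_lt// orbT.
have [|t1 [/andP[at1 t1r0] et1 Ht1]] :=
  first_time _ _ _ e ar0 (within_continuous_itvW _ _ _ _ _ (lexx a) r0b cf).
  by rewrite /e ge_min lexx.
have t1b := le_trans t1r0 r0b.
have cfN : {within `[a, t1], continuous (\- f)}.
  have cf1 := within_continuous_itvW _ _ _ _ _ (lexx a) t1b cf.
  by move=> x; apply: continuousN; exact: cf1.
have [|t0 [/andP[at0 t0t1] ct0 Ht0]] := last_time _ _ _ (- c) at1 cfN.
  by rewrite lerN2.
rewrite lerN2 in ct0.
have t01 : t0 < t1.
  rewrite lt_neqAle t0t1 andbT; apply/eqP => t0E; move: et1.
  by rewrite -t0E leNgt (le_lt_trans ct0).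
have [x||x] := @MVT R f df t0 t1 t01.
- rewrite in_itv/= => /andP[t0x xt1]; apply: dff.
  by rewrite (le_lt_trans at0 t0x) (lt_le_trans xt1).
- exact: within_continuous_itvW _ _ _ _ _ at0 t1b cf.
rewrite in_itv/= => /andP[t0x xt1] fE.
have xab : a < x < b by rewrite (le_lt_trans at0 t0x) (lt_le_trans xt1).
have dfx : df x <= 0.
  apply: fle => //; apply/andP; split.
    by have := Ht0 x; rewrite ltrN2; apply; rewrite t0x ltW.
  by rewrite (lt_trans _ ec')// Ht1// xt1 (le_trans at0)// ltW.
have : f t1 - f t0 <= 0 by rewrite fE mulr_le0_ge0// subr_ge0.
rewrite subr_le0 leNgt => /negP; apply.
by rewrite (le_lt_trans ct0) ?(lt_le_trans ce).
Qed.
End real_functions.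

(** * A single window of length at most 1/a *)

Section windows.
Context {R : realType}.
(** [V] is the deviation X(r) - r with the noise increment [n] since time [a] removed, which leaves
    a differentiable function; the deviation itself is U = [V + n]. *)
Variables (V n : R -> R) (a b eta : R).
Hypotheses (a4 : 4 <= a) (ab : a <= b) (bE : b <= a + a^-1).
Hypothesis cV : {within `[a, b], continuous V}.
Hypothesis dV : forall r, a < r < b ->
  is_derive r 1 V ((r + (V r + n r)) * (V r + n r) - 1).
Hypothesis nle : forall r, a <= r <= b -> `|n r| <= eta.

Let a_gt0 : 0 < a. Proof. exact: lt_le_trans a4. Qed.

(** [a * delta / 4] is the speed that the repulsion guarantees. Over a length of at most 1/a the
    gain is at most [delta / 4], so [V] stays comparable to [delta] within the strip used for
    [barrier]. *)
Let gain (delta r : R) : 0 < delta -> a <= r <= b ->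
  0 <= a * delta / 4 * (r - a) <= delta / 4.
Proof.
move=> d0 /andP[ar rb]; apply/andP; split.
  by rewrite mulr_ge0 ?subr_ge0// divr_ge0// mulr_ge0// ltW.
have ra : r - a <= a^-1 by rewrite lerBlDl (le_trans rb).
have -> : a * delta / 4 * (r - a) = delta / 4 * (a * (r - a)) by ring.
rewrite ler_piMr//; first by lra.
by rewrite -(mulfV (lt0r_neq0 a_gt0)) ler_wpM2l// ltW.
Qed.

(** In the strip, - 2 <= U <= - delta / 2 and r + U >= a / 2, so the drift (r + U) U is at most - a
    delta / 4; the term - 1 only helps. *)
Lemma window_down (delta : R) : 0 < delta <= 1 -> 16 * eta <= delta ->
  V a <= - delta ->
  forall r, a <= r <= b -> V r <= - delta - a * delta / 4 * (r - a).
Proof.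
move=> /andP[d0 d1] etad Va r0 abr0; rewrite lerBrDr.
have ha4 := a4; have ha0 := a_gt0.
set k := a * delta / 4.
apply: (@barrier R (fun r => V r + k * (r - a))
  (fun r => ((r + (V r + n r)) * (V r + n r) - 1) + k) a b _ (- (3 * delta / 4)))
  => //; first by lra.
- apply: within_continuousD => //; apply: continuous_subspaceT.
  exact: continuous_affine.
- move=> r /dV dVr.
  by apply: is_deriveD; exact: is_derive_affine.
- move=> r rab gr.
  have {}rab : a <= r <= b by move/andP: rab => [? ?]; rewrite !ltW.
  have := gain _ _ d0 rab; rewrite -/k; set m := k * (r - a) in gr *.
  move: (nle _ rab); rewrite ler_norml => nr mr.
  set U := V r + n r.
  have U1 : U <= - (delta / 2) by rewrite /U; lra.
  have U2 : - 2 <= U by rewrite /U; lra.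
  have : 0 <= (r + U - a / 2) * (- U) by rewrite mulr_ge0; lra.
  have : 0 <= a * (- U - delta / 2) by rewrite mulr_ge0; lra.
  rewrite /k; lra.
- by rewrite subrr mulr0 addr0.
Qed.

(** In the strip, U >= delta / 2, so the drift is at least a delta / 2 - 1. Here the term - 1 works
    against the gain, and [4 <= a * delta] absorbs it. *)
Lemma window_up (delta : R) : 0 < delta -> 4 <= a * delta ->
  16 * eta <= delta -> delta <= V a ->
  forall r, a <= r <= b -> delta + a * delta / 4 * (r - a) <= V r.
Proof.
have ha4 := a4; have ha0 := a_gt0.
move=> d0 ad4 etad Va r0 abr0.
set k := a * delta / 4.
suff : - V r0 + k * (r0 - a) <= - delta by lra.
apply: (@barrier R (fun r => - V r + k * (r - a))
  (fun r => - ((r + (V r + n r)) * (V r + n r) - 1) + k) a b _ (- (3 * delta / 4)))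
  => //; first by lra.
- apply: within_continuousD; first by move=> x; apply: continuousN; exact: cV.
  by apply: continuous_subspaceT; exact: continuous_affine.
- move=> r /dV dVr.
  by apply: is_deriveD; exact: is_derive_affine.
- move=> r rab gr.
  have {}rab : a <= r <= b by move/andP: rab => [? ?]; rewrite !ltW.
  have := gain _ _ d0 rab; rewrite -/k; set m := k * (r - a) in gr *.
  move: (nle _ rab); rewrite ler_norml => nr mr.
  set U := V r + n r.
  have U1 : delta / 2 <= U by rewrite /U; lra.
  have : 0 <= (r + U - a) * U by rewrite mulr_ge0; lra.
  have : 0 <= a * (U - delta / 2) by rewrite mulr_ge0; lra.
  rewrite /k; lra.
- by rewrite subrr mulr0 addr0 lerN2.
Qed.

(** Since V' >= V^2 / 4, the function 1/V + (r - a) / 4 does not increase. It starts at or below 1 /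
    (8 a), while the second term alone reaches 1 / (4 a) at the end of the window, which would make
    1/V negative. *)
Lemma riccati_blowup : b = a + a^-1 -> eta <= 1 -> 8 * a <= V a -> False.
Proof.
move=> bE'.
have ha4 := a4; have ha0 := a_gt0.
move=> eta1 Va.
(* [window_up] with delta = 8 a keeps [V] large, so that 1/V is defined on the whole window. *)
have V8 r : a <= r <= b -> 8 * a <= V r.
  move=> rab.
  have d0 : 0 < 8 * a by rewrite mulr_gt0.
  have := window_up _ d0 _ _ Va _ rab; have /andP[g0 _] := gain _ _ d0 rab.
  move=> H; apply: le_trans (H _ _); first by rewrite lerDl.
    have : 0 <= a * (a - 4) by rewrite mulr_ge0; lra.
    by lra.
  by lra.
have V0 r : a <= r <= b -> V r != 0.
  by move=> /V8 ?; apply: lt0r_neq0; lra.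
(* The derivative will be nonpositive everywhere, so the height 1 of the strip is arbitrary. *)
have ca : (V a)^-1 < (V a)^-1 + 1 by rewrite ltrDl.
suff /(_ b) : forall r, a <= r <= b ->
    (V r)^-1 + 4^-1 * (r - a) <= (V a)^-1.
  rewrite ab lexx => /(_ isT).
  have : 0 < (V b)^-1.
    by rewrite invr_gt0; apply: lt_le_trans (V8 b _); rewrite ?ab ?lexx//; lra.
  have : (V a)^-1 <= (8 * a)^-1 by rewrite lef_pV2// posrE; lra.
  rewrite invfM bE' addrAC subrr add0r.
  have : 0 < a^-1 by rewrite invr_gt0.
  lra.
apply: (@barrier R (fun r => (V r)^-1 + 4^-1 * (r - a))
  (fun r => - (V r) ^- 2 * ((r + (V r + n r)) * (V r + n r) - 1) + 4^-1)
  a b _ ((V a)^-1 + 1)) => //.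
- apply: within_continuousD; first by apply: within_continuousV => // r;
    rewrite /= in_itv/=; exact: V0.
  by apply: continuous_subspaceT; exact: continuous_affine.
- move=> r rab; apply: is_deriveD; last exact: is_derive_affine.
  apply: is_deriveV (dV _ rab); apply: V0.
  by move/andP: rab => [? ?]; rewrite !ltW.
- move=> r rab _.
  have {}rab : a <= r <= b by move/andP: rab => [? ?]; rewrite !ltW.
  move: (nle _ rab) (V8 _ rab); rewrite ler_norml => nr V8r.
  rewrite mulNr addrC subr_le0 ler_pdivlMl; last by rewrite exprn_gt0//; lra.
  set v := V r in nr V8r *; set U := v + n r.
  have U1 : v - 1 <= U by rewrite /U; lra.
  have r0 : 0 <= r by lra.
  have : 0 <= (U - (v - 1)) * (U + v - 1) by rewrite mulr_ge0; lra.
  have : 0 <= r * U by rewrite mulr_ge0; lra.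
  have : 0 <= v * (v - 32) by rewrite mulr_ge0; lra.
  rewrite expr2; lra.
- by rewrite subrr mulr0 addr0.
Qed.
End windows.

(** * The pathwise equation near the diagonal *)

Section integral_equation.
Context {R : realType}.
Implicit Types (f p Y : R -> R) (s x t a b : R).

Lemma Rintegral_is_derive f a b r : {within `[a, b], continuous f} ->
  a < r < b ->
  is_derive r 1 (fun y => \int[lebesgue_measure]_(u in `[a, y]) f u) (f r).
Proof.
move=> cf /andP[ar rb].
have fi : lebesgue_measure.-integrable `[a, b] (EFin \o f).
  by apply: continuous_compact_integrable => //; exact: segment_compact.
have fr : {for r, continuous f}.
  apply: within_continuous_continuous cf _; first exact: lt_trans rb.
  by rewrite in_itv/= ar rb.
have [dF F'] := continuous_FTC1_closed rb fi ar fr.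
by apply: DeriveDef => //; rewrite -derive1E.
Qed.

Variables (sigma : R) (p : R -> R).
Hypothesis cp : {within `[0, +oo[, continuous p}.

Lemma within_continuous_path a b : 0 <= a -> {within `[a, b], continuous p}.
Proof.
move=> a0; apply: continuous_subspaceW cp => r /=.
by rewrite !in_itv/= andbT => /andP[+ _]; exact: le_trans.
Qed.

Lemma within_continuous_drift s t Y : {within `[s, t], continuous Y} ->
  {within `[s, t], continuous (fun u => Y u * (Y u - u))}.
Proof.
move=> cY; apply: within_continuousM => //; apply: within_continuousB => //.
by apply: continuous_subspaceT => ?; exact: cvg_id.
Qed.

(** The path is only continuous, but Y - sigma p is a constant plus the integral of a continuous
    drift. *)
Lemma local_solution_is_derive s x t Y r : local_solution sigma p s x t Y ->
  s < r < t -> is_derive r 1 (fun u => Y u - sigma * p u) (Y r * (Y r - r)).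
Proof.
move=> [cY YE] /andP[sr rt].
have := @Rintegral_is_derive (fun u => Y u * (Y u - u)) s t r.
move=> /(_ (within_continuous_drift _ _ _ cY)); rewrite sr rt => /(_ isT) dF.
have dG := is_deriveD (is_derive_cst (x - sigma * p s) r 1) dF.
rewrite add0r in dG; apply: near_eq_is_derive dG.
have srt : r \in `]s, t[ by rewrite in_itv/= sr.
apply: filterS (near_in_itvoo srt) => u; rewrite in_itv/= => /andP[su ut].
rewrite YE ?ltW// addrfctE /=; ring.
Qed.

(** With U = Y - r the drift Y (Y - r) becomes (r + U) U, and the - 1 comes from differentiating the
    diagonal. This puts a solution in the form required by the window lemmas. *)
Lemma local_solution_window s x t Y a b :
  let n r := sigma * (p r - p a) in let V r := Y r - r - n r in
  0 <= s -> s <= a -> b <= t -> local_solution sigma p s x t Y ->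
  {within `[a, b], continuous V} /\ forall r, a < r < b ->
    is_derive r 1 V ((r + (V r + n r)) * (V r + n r) - 1).
Proof.
move=> n V s0 sa bt sol; split.
  have cpab := within_continuous_path _ b (le_trans s0 sa).
  rewrite /V; apply: within_continuousB; first apply: within_continuousB.
  - by have [cY _] := sol; exact: within_continuous_itvW cY.
  - by apply: continuous_subspaceT => ?; exact: cvg_id.
  apply: within_continuousM; first by apply: continuous_subspaceT => ?; exact: cvg_cst.
  by apply: within_continuousB => //; apply: continuous_subspaceT => ?; exact: cvg_cst.
move=> r /andP[ar rb].
have -> : V r + n r = Y r - r by rewrite /V; ring.
have -> : (r + (Y r - r)) * (Y r - r) - 1 = Y r * (Y r - r) - 1 by ring.
have -> : V = (fun u => (Y u - sigma * p u) - 1 * (u - sigma * p a)).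
  by apply/funext => u; rewrite /V/n; ring.
apply: is_deriveB; last exact: is_derive_affine.
by apply: local_solution_is_derive sol _; rewrite (le_lt_trans sa) ?(lt_le_trans rb).
Qed.

(** * Solutions started away from the diagonal *)

Section barriers.
(** [delta] abstracts the profile e a^-alpha, and [S] a time after which it dominates 16 times the
    oscillation of the noise over each window. *)
Variables (S : R) (delta : R -> R).
Hypothesis S20 : 20 <= S.
Hypothesis delta01 : forall a, S <= a -> 0 < delta a <= 1.
Hypothesis delta_decr : forall a b, S <= a -> a <= b -> delta b <= delta a.
Hypothesis cdelta : forall a b, S <= a -> {within `[a, b], continuous delta}.
Hypothesis osc : forall a r, S <= a -> a <= r <= a + a^-1 ->
  16 * `|sigma * (p r - p a)| <= delta a.

(** Start a window at the last time tau at which Y lies at least delta below the diagonal. A window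
    that contains [r0] gives the claim; a complete one ends with U <= - (1 + 1/4 - 1/16) delta(tau),
    below - delta again, against the choice of tau. *)
Lemma local_solution_below s x t Y : S <= s -> x <= s - delta s ->
  local_solution sigma p s x t Y -> forall r, s <= r <= t -> Y r <= r.
Proof.
move=> Ss xs sol r0 /andP[sr0 r0t].
have hS := S20.
have Ys : Y s = x.
  have [_ ->] := sol; last by rewrite lexx (le_trans sr0).
  by rewrite set_itv1 Rintegral_set1 subrr mulr0 !addr0.
have [||tau [/andP[stau taur] ctau H]] :=
  last_time (fun r => r - Y r - delta r) s r0 0 sr0.
- apply: within_continuousB; last exact: cdelta.
  apply: within_continuousB; first by apply: continuous_subspaceT => ?; exact: cvg_id.
  by have [cY _] := sol; exact: within_continuous_itvW cY.
- by rewrite Ys; lra.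
have Stau := le_trans Ss stau.
have /andP[d0 d1] := delta01 _ Stau.
have tau0 : 0 < tau by lra.
pose b := Num.min r0 (tau + tau^-1).
have taub : tau <= b by rewrite /b le_min taur lerDl invr_ge0 ltW.
have br0 : b <= r0 by rewrite /b ge_min lexx.
have btau : b <= tau + tau^-1 by rewrite /b ge_min lexx orbT.
have [||cV dV] := @local_solution_window s x t Y tau b _ stau _ sol.
- by lra.
- exact: le_trans br0 r0t.
have oscb r : tau <= r <= b -> `|sigma * (p r - p tau)| <= delta tau / 16.
  move=> /andP[tr rb]; rewrite ler_pdivlMr// mulrC osc//.
  by rewrite tr (le_trans rb).
have tau4 : 4 <= tau by lra.
have := @window_down R _ _ tau b _ tau4 btau cV dV oscb (delta tau).
rewrite d0 d1 => /(_ isT) /(_ _ _ b).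
rewrite taub lexx subrr mulr0 subr0 => H'.
have {H'} : Y b - b - sigma * (p b - p tau) <=
    - delta tau - tau * delta tau / 4 * (b - tau) by apply: H' => //; lra.
have := oscb b; rewrite taub lexx => /(_ isT); rewrite ler_norml => ob Vb.
have [r0b|br] := leP r0 (tau + tau^-1).
  have bE : b = r0 by rewrite /b min_l.
  rewrite -bE.
  have : 0 <= tau * delta tau / 4 * (b - tau).
    by rewrite mulr_ge0 ?subr_ge0// divr_ge0// mulr_ge0// ltW.
  lra.
have bE : b = tau + tau^-1 by rewrite /b min_r// ltW.
have tb : tau < b by rewrite bE ltrDl invr_gt0.
have := H b; rewrite tb br0 => /(_ isT).
have : tau * delta tau / 4 * (b - tau) = delta tau / 4.
  rewrite bE addrAC subrr add0r; field; exact: lt0r_neq0.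
have := delta_decr _ _ Stau (ltW tb).
lra.
Qed.

Lemma no_global_solution s x : 
  (forall a, S <= a -> 4 <= a * delta a) ->
  S <= s -> s + delta s <= x ->
  exists2 T, s < T & forall Y, ~ local_solution sigma p s x T Y.
Proof.
move=> ad4 Ss xs; have hS := S20.
have /andP[ds0 ds1] := delta01 _ Ss; set d := delta s in ds0 ds1 xs.
have s0 : 0 <= s by lra.
(* Chosen so that d D^2 = 8 (s + 1) D >= 8 (s + D): after a time D the quadratic barrier exceeds 8
   t, the threshold of [riccati_blowup]. *)
pose D := 8 * (s + 1) / d.
have D1 : 1 <= D by rewrite /D ler_pdivlMr//; lra.
have DE : d * D = 8 * (s + 1) by rewrite /D; field; exact: lt0r_neq0.
pose T := s + D; have sT : s <= T by rewrite /T; lra.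
(* The extra unit of time leaves room for a window that starts before [T] and ends after it. *)
exists (T + 1); first by lra.
move=> Y sol.
pose bar r := d * (1 + (r - s)) ^+ 2.
have cbar : continuous bar.
  move=> r; apply: cvgM; first exact: cvg_cst.
  apply: cvgM; apply: cvgD; try exact: cvg_cst;
    by apply: cvgB; [exact: cvg_id|exact: cvg_cst].
have Ys : Y s = x.
  have [_ ->] := sol; last by rewrite lexx; lra.
  by rewrite set_itv1 Rintegral_set1 subrr mulr0 !addr0.
have [||tau [/andP[stau tauT] ctau H]] :=
  last_time (fun r => Y r - r - bar r) s T 0 sT.
- apply: within_continuousB; last exact: continuous_subspaceT.
  apply: within_continuousB; last by apply: continuous_subspaceT => ?; exact: cvg_id.
  by have [cY _] := sol; apply: within_continuous_itvW cY => //; lra.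
- by rewrite Ys /bar subrr addr0 expr1n mulr1; lra.
have Stau := le_trans Ss stau.
have /andP[d0 d1] := delta01 _ Stau.
have tau0 : 0 < tau by lra.
have tau4 : 4 <= tau by lra.
have itau0 : 0 < tau^-1 by rewrite invr_gt0.
have itau : tau^-1 <= 20^-1 by rewrite lef_pV2// ?posrE; lra.
pose b := tau + tau^-1.
have taub : tau <= b by rewrite /b; lra.
have [|cV dV] := @local_solution_window s x (T + 1) Y tau b s0 stau _ sol.
- by rewrite /b; lra.
have bartau : delta tau <= bar tau.
  apply: le_trans (delta_decr _ _ Ss stau) _.
  by rewrite /bar ler_peMr ?exprn_ege1//; [exact: ltW|lra].
have oscb r : tau <= r <= b -> `|sigma * (p r - p tau)| <= delta tau / 16.
  by move=> trb; rewrite ler_pdivlMr// mulrC osc.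
have bar0 : 0 < bar tau by exact: lt_le_trans bartau.
have Vup := @window_up R _ _ tau b _ tau4 (lexx b) cV dV oscb (bar tau) bar0.
have {Vup} : forall r, tau <= r <= b ->
   bar tau + tau * bar tau / 4 * (r - tau) <= Y r - r - sigma * (p r - p tau).
  apply: Vup.
  - by apply: le_trans (ad4 _ Stau) _; rewrite ler_pM2l.
  - by lra.
  - by rewrite subrr mulr0 subr0; lra.
move=> /(_ b); rewrite taub lexx => /(_ isT) Vb.
(* A window ending before [T] contradicts the choice of tau: U is multiplied by at least 1 + 1/4 -
   1/16 = 19/16, the barrier by at most (21/20)^2 since 1/tau <= 1/20. So tau is within 1/tau of
   [T], where the barrier is already above 8 tau. *)
have [bT|Tb] := leP b T.
  have tb : tau < b by rewrite /b; lra.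
  have := H b; rewrite tb bT => /(_ isT).
  have : tau * bar tau / 4 * (b - tau) = bar tau / 4.
    rewrite /b addrAC subrr add0r; field; exact: lt0r_neq0.
  have := oscb b; rewrite taub lexx => /(_ isT); rewrite ler_norml => ob.
  suff : bar b <= 19 / 16 * bar tau by lra.
  rewrite /bar /b [leRHS]mulrCA ler_pM2l//.
  set m := 1 + (tau - s); have m1 : 1 <= m by rewrite /m; lra.
  have : (1 + (tau + tau^-1 - s)) ^+ 2 <= (21 / 20 * m) ^+ 2.
    by rewrite ler_sqr ?nnegrE; rewrite /m in m1 *; lra.
  rewrite exprMn; have : 0 <= m ^+ 2 by rewrite sqr_ge0.
  lra.
apply: (@riccati_blowup R _ _ tau b _ tau4 taub (lexx b) cV dV oscb) => //.
  by lra.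
rewrite subrr mulr0 subr0.
suff : 8 * tau <= bar tau by lra.
have : D <= 1 + (tau - s).
  by move: Tb; rewrite /b /T; lra.
set m := 1 + (tau - s) => Dm.
have dm : d * D ^+ 2 <= d * m ^+ 2 by rewrite ler_pM2l// ler_sqr// ?nnegrE; lra.
rewrite /bar -/m.
have : d * D ^+ 2 = 8 * (s + 1) * D by rewrite expr2 mulrA DE.
have : 0 <= s * (D - 1) by rewrite mulr_ge0; lra.
rewrite /T in tauT; lra.
Qed.
End barriers.
End integral_equation.

(** * Blow-up *)

Section blowup.
Context {R : realType}.
Variables (sigma : R) (p : R -> R).
Hypothesis cp : {within `[0, +oo[, continuous p}.
Implicit Types (Y : R -> R) (s x t : R).

Lemma path_bounded a b : 0 <= a <= b ->
  exists B, forall r, a <= r <= b -> `|sigma * p r| <= B.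
Proof.
move=> /andP[a0 ab].
have [|c _ Hc] := @EVT_max R (fun r => `|sigma * p r|) a b ab.
  suff cpr : {within `[a, b], continuous (fun r => sigma * p r)}.
    by move=> r; apply: cvg_norm; exact: cpr.
  apply: within_continuousM; first by apply: continuous_subspaceT => ?; exact: cvg_cst.
  exact: within_continuous_path.
by exists `|sigma * p c| => r rab; apply: Hc; rewrite in_itv.
Qed.

(** At negative values the drift Y (Y - u) is nonnegative. After the last time above min(x, 0), only
    the noise can push Y down, by at most 2 B. *)
Lemma local_solution_ge s x t Y B : 0 <= s -> local_solution sigma p s x t Y ->
  (forall r, s <= r <= t -> `|sigma * p r| <= B) ->
  forall r, s <= r <= t -> Num.min x 0 - 2 * B <= Y r.
Proof.
move=> s0 sol pB r /andP[sr rt]; rewrite leNgt; apply/negP => Yr.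
have B0 : 0 <= B.
  by apply: le_trans (pB s _); rewrite ?normr_ge0// lexx (le_trans sr).
set m := Num.min x 0 in Yr.
have m0 : m <= 0 by rewrite /m ge_min lexx orbT.
have mx : m <= x by rewrite /m ge_min lexx.
have Ys : Y s = x.
  have [_ ->] := sol; last by rewrite lexx (le_trans sr).
  by rewrite set_itv1 Rintegral_set1 subrr mulr0 !addr0.
have cY : {within `[s, r], continuous Y}.
  by have [cY _] := sol; exact: within_continuous_itvW cY.
have [|tau [/andP[stau taur] mtau H]] := last_time Y s r m sr cY.
  by rewrite Ys.
have {}taur : tau < r.
  by rewrite lt_neqAle taur andbT; apply/eqP => E; rewrite E in mtau; lra.
have [|xi|xi] := @MVT R (fun u => Y u - sigma * p u) (fun u => Y u * (Y u - u)) _ _ taur.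
- move=> u; rewrite in_itv/= => /andP[tu ur].
  by apply: local_solution_is_derive sol _ => //;
    rewrite (le_lt_trans stau) ?(lt_le_trans ur).
- apply: within_continuousB; first exact: within_continuous_itvW cY.
  apply: within_continuousM; first by apply: continuous_subspaceT => ?; exact: cvg_cst.
  by apply: within_continuous_path => //; exact: le_trans stau.
rewrite in_itv/= => /andP[txi xir].
have Yxi : Y xi < m by apply: H; rewrite txi ltW.
have : 0 <= (- Y xi) * (xi - Y xi) * (r - tau).
  by rewrite !mulr_ge0//; lra.
have := pB r; rewrite sr rt ler_norml => /(_ isT).
have := pB tau; rewrite stau (ltW (lt_le_trans taur rt)) ler_norml => /(_ isT).
lra.
Qed.

Lemma blowup_timeE s x :
  blowup_time sigma p s x = ereal_sup (range (hitting_time sigma p s x)).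
Proof.
apply/cvg_lim => //; apply: ereal_nondecreasing_cvgn.
exact: nondecreasing_hitting_time.
Qed.

(** Up to any finite time T, Y is bounded above by the diagonal and below by [local_solution_ge], so
    levels beyond that bound cannot be hit before T. *)
Lemma blowup_time_pinfty s x : 0 <= s ->
  (forall t Y, local_solution sigma p s x t Y ->
    forall r, s <= r <= t -> Y r <= r) ->
  blowup_time sigma p s x = +oo%E.
Proof.
move=> s0 Yle; apply/eqP; rewrite -leye_eq leNgt; apply/negP => fin.
have [T sT bT] : exists2 T : R, s <= T & (blowup_time sigma p s x < T%:E)%E.
  case: (blowup_time _ _ _ _) fin => [b _|//|_]; last by exists s; rewrite ?ltNyr.
  exists (Num.max s (b + 1)); first by rewrite le_max lexx.
  by rewrite lte_fin lt_max ltrDl ltr01 orbT.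
have [B pB] : exists B, forall r, s <= r <= T -> `|sigma * p r| <= B.
  by apply: path_bounded; rewrite s0.
pose M := T + `|x| + 2 * B.
have [n Mn] : exists n : nat, M < n%:R.
  by exists (Num.truncn M).+1; exact: truncnS_gt.
have : (hitting_time sigma p s x n < T%:E)%E.
  apply: le_lt_trans bT; rewrite blowup_timeE.
  by apply: ereal_sup_ubound; exists n.
move=> /ereal_inf_lt[_ [t [st [y [_ [Y sol Yt] ny]] <-]]]; rewrite lte_fin => tT.
have stt : s <= t <= t by rewrite lexx ltW.
have pB' r : s <= r <= t -> `|sigma * p r| <= B.
  by move=> /andP[sr rt]; apply: pB; rewrite sr (le_trans rt)// ltW.
have Yup := Yle _ _ sol _ stt.
have := local_solution_ge _ _ _ _ _ s0 sol pB' _ stt.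
have B0 : 0 <= B.
  by apply: le_trans (pB' s _); rewrite ?normr_ge0// lexx ltW.
have x0 : - `|x| <= Num.min x 0.
  by rewrite le_min oppr_le0 normr_ge0 lerNnormlW.
have xx := normr_ge0 x.
move=> Ydn; have : `|y| <= M by rewrite -Yt ler_norml /M; apply/andP; split; lra.
by rewrite leNgt (lt_le_trans Mn ny).
Qed.

End blowup.

(** * Existence of solutions *)

Section picard.
Context {R : realType}.

Lemma exprn_unbounded (r x : R) : 1 < r -> exists k, x <= r ^+ k.
Proof.
move=> r1.
have bern k : 1 + k%:R * (r - 1) <= r ^+ k.
  elim: k => [|k IH]; first by rewrite mul0r addr0 expr0.
  have rk1 : 1 <= r ^+ k by rewrite exprn_ege1// ltW.
  have : 0 <= (r ^+ k - 1) * (r - 1) by rewrite mulr_ge0 ?subr_ge0// ltW.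
  by rewrite exprS -natr1; lra.
exists (Num.truncn (x / (r - 1))).+1; apply: le_trans (bern _).
rewrite ler_wpDl// -ler_pdivrMr ?subr_gt0//.
by rewrite ltW// truncnS_gt.
Qed.

Lemma exprn_small (q M e : R) : 0 < q < 1 -> 0 < e -> exists k, M * q ^+ k <= e.
Proof.
move=> /andP[q0 q1] e0.
have [|k Hk] := exprn_unbounded q^-1 (M / e); first by rewrite invf_gt1.
exists k; rewrite -ler_pdivlMr ?exprn_gt0//.
by move: Hk; rewrite ler_pdivrMr// exprVn mulrC.
Qed.

Lemma half_expn_small (M e : R) : 0 < e -> exists k, M / 2 ^+ k <= e.
Proof.
move=> e0; have [|k] := exprn_small 2^-1 M e _ e0.
  by rewrite invr_gt0 ltr0n invf_lt1 ?ltr1n.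
by rewrite exprVn; exists k.
Qed.

(** The intervals of radius 2 K / 2^k, the tail of the geometric series, around u k are nested; the
    limit is the supremum of their left ends. *)
Lemma geometric_limit (u : nat -> R) (K : R) :
  (forall k, `|u k.+1 - u k| <= K / 2 ^+ k) ->
  exists l, forall k, `|l - u k| <= 2 * K / 2 ^+ k.
Proof.
move=> uK; pose e k : R := 2 * K / 2 ^+ k.
have eS k : e k = e k.+1 + K / 2 ^+ k.
  by rewrite /e exprS; field; rewrite expf_neq0.
have e0 k : 0 <= e k.
  by rewrite /e -mulrA mulr_ge0// (le_trans _ (uK k)).
have lo : {homo (fun k => u k - e k) : k m / (k <= m)%N >-> k <= m}.
  apply: homo_leq => // [? ? ?|k]; first exact: le_trans.
  by have := uK k; rewrite ler_norml (eS k); have := eS k; rewrite {1}/e; lra.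
have hi : {homo (fun k => u k + e k) : k m / (k <= m)%N >-> m <= k}.
  apply: (@homo_leq _ _ (fun x y => y <= x)) => // [? ? ? /[swap]|k]; first exact: le_trans.
  by have := uK k; rewrite ler_norml (eS k); lra.
have lohi k m : u k - e k <= u m + e m.
  apply: le_trans (lo _ _ (leq_maxl k m)) _.
  apply: le_trans (hi _ _ (leq_maxr k m)).
  by have := e0 (maxn k m); lra.
exists (sup (range (fun k => u k - e k))) => k; rewrite -/(e k) ler_distl.
apply/andP; split.
  by apply: ub_le_sup; [exists (u 0%N + e 0%N) => _ [m _ <-]|exists k].
by apply: ge_sup; [exists (u 0%N - e 0%N); exists 0%N|move=> _ [m _ <-]].
Qed.

Lemma uniform_limit_within_continuous (u : nat -> R -> R) (Y : R -> R)
    (A : set R) (K : R) :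
  (forall k, {within A, continuous (u k)}) ->
  (forall k r, A r -> `|Y r - u k r| <= K / 2 ^+ k) ->
  {within A, continuous Y}.
Proof.
move=> cu uY; apply/subspace_continuousP => x Ax.
apply/cvgrPdist_le => e e0.
have [k ke] : exists k, K / 2 ^+ k <= e / 3.
  by apply: half_expn_small; rewrite divr_gt0.
have e30 : 0 < e / 3 by rewrite divr_gt0.
have /subspace_continuousP/(_ _ Ax)/cvgrPdist_le/(_ _ e30) := cu k.
rewrite !near_withinE; apply: filterS => y /[swap] Ay /(_ Ay).
have := uY k _ Ay; have := uY k _ Ax; rewrite /from_subspace !ler_norml => *; apply/andP; split; lra.
Qed.

Lemma within_continuous_Rintegral (f : R -> R) (s T : R) : s <= T ->
  {within `[s, T], continuous f} ->
  {within `[s, T], continuous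
    (fun r => \int[lebesgue_measure]_(u in `[s, r]) f u)}.
Proof.
move=> sT cf; apply: parameterized_integral_continuous => //.
by apply: continuous_compact_integrable => //; exact: segment_compact.
Qed.

(** The difference of the two sides starts at - C and has nonpositive derivative. This is the
    estimate behind contraction in an exponentially weighted norm. *)
Lemma Rintegral_le_expR (f : R -> R) (s T k C : R) : s <= T -> 0 <= C ->
  {within `[s, T], continuous f} ->
  (forall r, s <= r <= T -> f r <= k * (C * expR (k * (r - s)))) ->
  forall r, s <= r <= T ->
    \int[lebesgue_measure]_(u in `[s, r]) f u <= C * expR (k * (r - s)).
Proof.
move=> sT C0 cf fle r srT; rewrite -subr_le0.
apply: (@barrier R (fun r => (\int[lebesgue_measure]_(u in `[s, r]) f u)
    - C * expR (k * (r - s)))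
  (fun r => f r - k * (C * expR (k * (r - s)))) s T 0 1) => //.
- apply: within_continuousB; first exact: within_continuous_Rintegral.
  apply: continuous_subspaceT => y; apply: cvgM; first exact: cvg_cst.
  apply: (@continuous_comp _ _ _ (fun u => k * (u - s)) expR).
    exact: continuous_affine.
  exact: continuous_expR.
- move=> y syT; apply: is_deriveB; first exact: Rintegral_is_derive syT.
  have dE := @is_derive1_comp R expR (fun u => k * (u - s)) y _ _
    (is_derive_expR _) (is_derive_affine k s y).
  have -> : k * (C * expR (k * (y - s))) = C *: (expR (k * (y - s)) * k).
    by rewrite /GRing.scale/=; ring.
  exact: is_deriveZ.
- by move=> y /andP[sy yT] _; rewrite subr_le0 fle// !ltW.
- by rewrite set_itv1 Rintegral_set1 subrr mulr0 expR0 mulr1 sub0r oppr_le0.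
Qed.

(** Picard iteration from [N]. In the supremum norm with weight exp(2 L (r - s)) the map [phi]
    contracts by 1/2 on all of [s, T], however long, so no gluing of short intervals is needed. *)
Lemma picard_lindelof (s T L : R) (F : R -> R -> R) (N : R -> R) :
  s <= T -> 0 < L -> {within `[s, T], continuous N} ->
  (forall Y : R -> R, {within `[s, T], continuous Y} ->
    {within `[s, T], continuous (fun u => F u (Y u))}) ->
  (forall u y z, s <= u <= T -> `|F u y - F u z| <= L * `|y - z|) ->
  exists2 Y : R -> R, {within `[s, T], continuous Y} &
    forall r, s <= r <= T ->
      Y r = N r + \int[lebesgue_measure]_(u in `[s, r]) F u (Y u).
Proof.
move=> sT L0 cN cF lip.
pose phi (Y : R -> R) r := N r + \int[lebesgue_measure]_(u in `[s, r]) F u (Y u).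
have cphi (Y : R -> R) : {within `[s, T], continuous Y} ->
    {within `[s, T], continuous (phi Y)}.
  move=> /cF cFY; apply: within_continuousD => //.
  exact: within_continuous_Rintegral.
pose w r := expR (2 * L * (r - s)).
have w1 r : s <= r -> 1 <= w r.
  by move=> sr; rewrite -expR0 ler_expR !mulr_ge0 ?subr_ge0// ltW.
have contr (Y Z : R -> R) (C : R) : {within `[s, T], continuous Y} ->
    {within `[s, T], continuous Z} -> 0 <= C ->
    (forall r, s <= r <= T -> `|Y r - Z r| <= C * w r) ->
    forall r, s <= r <= T -> `|phi Y r - phi Z r| <= C / 2 * w r.
  move=> cY cZ C0 YZ.
  (* The hypotheses are symmetric in both functions, so a one-sided bound suffices. *)
  suff half (Y' Z' : R -> R) : {within `[s, T], continuous Y'} ->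
      {within `[s, T], continuous Z'} ->
      (forall r, s <= r <= T -> `|Y' r - Z' r| <= C * w r) ->
      forall r, s <= r <= T -> phi Y' r - phi Z' r <= C / 2 * w r.
    move=> r srT; rewrite ler_norml; apply/andP; split; last exact: half.
    rewrite lerNl opprB; apply: half => // y ?.
    by rewrite distrC YZ.
  move=> {Y Z} {}cY {}cZ {}YZ r srT.
  have /andP[sr rT] := srT.
  have intF V : {within `[s, T], continuous V} ->
      lebesgue_measure.-integrable `[s, r] (EFin \o (fun u => F u (V u))).
    move=> /cF cFV; apply: continuous_compact_integrable => //.
      exact: segment_compact.
    exact: within_continuous_itvW cFV.
  rewrite /phi opprD addrACA subrr add0r.
  rewrite -RintegralB//; [|exact: intF|exact: intF].
  apply: (@Rintegral_le_expR _ s T (2 * L) (C / 2)) => //.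
  - by rewrite divr_ge0.
  - by apply: within_continuousB; exact: cF.
  move=> y syT; apply: le_trans (ler_norm _) _.
  apply: le_trans (lip _ _ _ syT) _.
  have -> : 2 * L * (C / 2 * expR (2 * L * (y - s))) = L * (C * w y).
    by rewrite /w; field.
  by rewrite ler_pM2l// YZ.
pose it k := iter k phi N.
have cit k : {within `[s, T], continuous (it k)}.
  by elim: k => //= k; exact: cphi.
have [|c _ Hc] := @EVT_max R (fun r => `|it 1%N r - it 0%N r|) s T sT.
  have c10 := within_continuousB _ _ _ (cit 1%N) (cit 0%N).
  by move=> r; apply: cvg_norm; exact: c10.
set C := `|it 1%N c - it 0%N c| in Hc.
have C0 : 0 <= C by exact: normr_ge0.
have itC k r : s <= r <= T -> `|it k.+1 r - it k r| <= C / 2 ^+ k * w r.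
  elim: k r => [|k IH] r srT.
    rewrite expr0 divr1; apply: le_trans (Hc r _) _; first by rewrite in_itv.
    by rewrite ler_peMr// w1//; case/andP: srT.
  have := contr _ _ (C / 2 ^+ k) (cit k.+1) (cit k) _ IH _ srT.
  rewrite exprSr invfM mulrA; apply.
  by rewrite divr_ge0// exprn_ge0.
pose K := C * w T.
have wT r : s <= r <= T -> w r <= w T.
  move=> /andP[_ rT]; rewrite ler_expR ler_wpM2l ?lerB//.
  by rewrite mulr_ge0// ltW.
have itK k r : s <= r <= T -> `|it k.+1 r - it k r| <= K / 2 ^+ k.
  move=> srT; apply: le_trans (itC k r srT) _.
  by rewrite /K mulrAC ler_wpM2r ?invr_ge0 ?exprn_ge0// ler_wpM2l// wT.
have /choice[Y HY] : forall r, exists l,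
    s <= r <= T -> forall k, `|l - it k r| <= 2 * K / 2 ^+ k.
  move=> r; have [srT|] := boolP (s <= r <= T); last by exists 0.
  by have [l Hl] := geometric_limit (fun k => it k r) K (fun k => itK k r srT); exists l.
have K0 : 0 <= K by rewrite mulr_ge0// ltW// expR_gt0.
have cY : {within `[s, T], continuous Y}.
  apply: (uniform_limit_within_continuous it _ _ (2 * K)) => // k r /=.
  by rewrite in_itv/= => /HY; exact.
(* Y is a fixed point because it is within (K + K w(T)) / 2^k of [phi Y] for every k, through the
   iterate k + 1. *)
exists Y => // r srT; apply/eqP; rewrite -/(phi Y r) -subr_eq0 -normr_le0.
apply/ler_addgt0Pl => e e0; rewrite addr0.
have [k ke] := half_expn_small (K + K * w T) e e0.
apply: le_trans ke; rewrite mulrDl.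
have -> : Y r - phi Y r = (Y r - it k.+1 r) + (phi (it k) r - phi Y r).
  by rewrite /=; ring.
apply: le_trans (ler_normD _ _) _; apply: lerD.
  apply: le_trans (HY r srT k.+1) _.
  by rewrite exprS invfM mulrA (mulrC 2) mulfK.
have k0 : 0 <= 2 * K / 2 ^+ k.
  apply: divr_ge0; last exact: exprn_ge0.
  by apply: mulr_ge0.
apply: le_trans (contr (it k) Y (2 * K / 2 ^+ k) (cit k) cY k0 _ r srT) _.
  move=> y syT; rewrite distrC; apply: le_trans (HY y syT k) _.
  by rewrite ler_peMr// w1//; case/andP: syT.
have -> : 2 * K / 2 ^+ k / 2 = K / 2 ^+ k by field; rewrite expf_neq0.
by rewrite mulrAC ler_wpM2r ?invr_ge0 ?exprn_ge0// ler_wpM2l// wT.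
Qed.
End picard.

(** * Truncated drift and exit times *)

Section exit.
Context {R : realType}.
Variables (sigma : R) (p : R -> R).
Hypothesis cp : {within `[0, +oo[, continuous p}.
Implicit Types (Y : R -> R) (s x t : R).

(** Clamping the state to [-K, K] makes the drift globally Lipschitz, with constant 2 K + T because
    times lie in [0, T]. *)
Lemma truncated_solution s T x K : 0 <= s -> s <= T -> 0 < K ->
  let c y := Num.max (- K) (Num.min y K) in
  exists2 Y : R -> R, {within `[s, T], continuous Y} &
    forall r, s <= r <= T ->
      Y r = x + \int[lebesgue_measure]_(u in `[s, r]) (c (Y u) * (c (Y u) - u))
        + sigma * (p r - p s).
Proof.
move=> s0 sT K0 c.
have KK : - K <= K by lra.
have [||||Y cY YE] := @picard_lindelof R s T (2 * K + T)
  (fun u y => c y * (c y - u)) (fun r => x + sigma * (p r - p s)) sT.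
- by lra.
- have cst_cont (z : R) : {within `[s, T], continuous (fun=> z)}.
    by apply: continuous_subspaceT => ?; exact: cvg_cst.
  apply: within_continuousD => //; apply: within_continuousM => //.
  by apply: within_continuousB => //; exact: within_continuous_path.
- move=> Y cY.
  apply: (within_continuous_drift s T (fun u => c (Y u))).
  apply: (@within_continuous_comp _ _ _ `[s, T] Y c) => // y _; exact: continuous_clamp.
- move=> u y z /andP[su uT].
  have -> : c y * (c y - u) - c z * (c z - u) = (c y + c z - u) * (c y - c z).
    by ring.
  rewrite normrM; apply: ler_pM => //; last exact: clamp_contract.
  have := clamp_itv _ _ y KK; have := clamp_itv _ _ z KK; rewrite -/(c y) -/(c z).
  by move=> ? ?; rewrite ler_norml; apply/andP; split; lra.
by exists Y => // r /YE ->; rewrite addrAC.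
Qed.

(** The truncated solution solves the original equation for as long as its modulus is at most K. *)
Lemma global_or_exit s T x K : 0 <= s -> s <= T -> `|x| < K ->
  (exists Y, local_solution sigma p s x T Y) \/
  exists t Y, [/\ s < t <= T, local_solution sigma p s x t Y & K <= `|Y t|].
Proof.
move=> s0 sT xK; have K0 : 0 < K by exact: le_lt_trans xK.
have [Y cY] := truncated_solution _ _ x _ s0 sT K0.
move=> YE.
have sol t : s <= t <= T -> (forall r, s <= r <= t -> `|Y r| <= K) ->
    local_solution sigma p s x t Y.
  move=> /andP[st tT] YK; split; first exact: within_continuous_itvW cY.
  move=> r /andP[sr rt]; rewrite YE ?sr ?(le_trans rt)//.
  congr (_ + _ + _); apply: eq_Rintegral => u; rewrite inE/= in_itv/= => /andP[su ur].
  rewrite clamp_id// -ler_norml YK// su /=; exact: le_trans rt.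
have [YK|/existsNP[r /not_implyP[/andP[sr rT] /negP]]] :=
    pselect (forall r, s <= r <= T -> `|Y r| <= K).
  by left; exists Y; apply: sol => //; rewrite sT lexx.
rewrite -ltNge => /ltW KYr; right.
have cnY b : b <= T -> {within `[s, b], continuous (fun u => `|Y u|)}.
  move=> bT; have cYb := within_continuous_itvW Y _ _ s b (lexx s) bT cY.
  by move=> u; apply: cvg_norm; exact: cYb.
have [t [/andP[st tr] KYt H]] := first_time (fun u => `|Y u|) s r K sr (cnY _ rT) KYr.
have tT := le_trans tr rT.
have Ys : Y s = x.
  by rewrite YE ?lexx ?sT// set_itv1 Rintegral_set1 subrr mulr0 !addr0.
have {}st : s < t.
  rewrite lt_neqAle st andbT; apply/eqP => E.
  by move: KYt; rewrite -E Ys leNgt xK.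
(* At the exit time itself the clamp must still be inactive; an overshoot would mean an earlier
   passage at K. *)
have Yt : `|Y t| <= K.
  rewrite leNgt; apply/negP => Yt.
  have [|d] := IVT (v := K) (ltW st) (cnY _ tT).
    by rewrite Ys ge_min le_max (ltW xK) (ltW Yt) orbT.
  rewrite in_itv/= => /andP[sd dt] Yd.
  have : d < t by rewrite lt_neqAle dt andbT; apply/eqP => E; rewrite -E Yd ltxx in Yt.
  by move=> dlt; have := H d; rewrite sd dlt Yd ltxx => /(_ isT).
exists t, Y; split => //; first by rewrite st.
apply: sol; first by rewrite ltW.
move=> u /andP[su]; rewrite le_eqVlt => /predU1P[->//|ut].
by apply/ltW/H; rewrite su.
Qed.

(** Without a solution up to T, every level must be reached by time T, which bounds all hitting
    times. *)
Lemma blowup_time_fin s x T : 0 <= s -> s < T ->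
  (forall Y, ~ local_solution sigma p s x T Y) ->
  (blowup_time sigma p s x < +oo)%E.
Proof.
move=> s0 sT nosol; apply: (@le_lt_trans _ _ T%:E); last exact: ltry.
rewrite blowup_timeE; apply: ge_ereal_sup => _ [n _ <-].
pose K := Num.max n%:R (`|x| + 1).
have xK : `|x| < K by rewrite /K lt_max ltrDl ltr01 orbT.
have [[Y /nosol]//|[t [Y [/andP[st tT] sol KYt]]]] :=
  global_or_exit _ _ _ _ s0 (ltW sT) xK.
apply: (@le_trans _ _ t%:E); last by rewrite lee_fin.
apply: ereal_inf_lbound; exists t => //; split => //.
exists (Y t); first by split; [exact: ltW|exists Y].
by apply: le_trans KYt; rewrite /K le_max lexx.
Qed.
End exit.

(** * Oscillation of the noise *)

Section chaining.
Context {R : realType}.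
Variables (p : R -> R) (q : R) (n0 : nat).
Hypothesis cp : {within `[0, +oo[, continuous p}.
Hypothesis q01 : 0 < q < 1.
(** The 4^(k+1) increments of length 2^-k reach time 2^(k+2), which leaves room for a window
    starting before 2^(k+1). *)
Hypothesis incr : forall k j, (n0 <= k)%N -> (j < 4 ^ k.+1)%N ->
  `|p (j.+1%:R / 2 ^+ k) - p (j%:R / 2 ^+ k)| <= q ^+ k.

Let dyad (x : R) k := (Num.truncn (x * 2 ^+ k))%:R / 2 ^+ k : R.

Let dyad_itv x k : 0 <= x -> dyad x k <= x < dyad x k + (2 ^+ k)^-1.
Proof.
move=> x0; have := @truncn_itv R (x * 2 ^+ k).
rewrite mulr_ge0 ?exprn_ge0// => /(_ isT) /andP[h1 h2].
rewrite /dyad ler_pdivrMr ?exprn_gt0// h1 /= -[X in _ + X]mul1r -mulrDl.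
by rewrite ltr_pdivlMr ?exprn_gt0// natr1.
Qed.

Let q_ge0 : 0 <= q. Proof. by case/andP: q01 => /ltW. Qed.
Let q1_gt0 : 0 < 1 - q. Proof. by rewrite subr_gt0; case/andP: q01. Qed.

(** Passing to the next level appends one binary digit, so consecutive dyadic approximations
    coincide or are neighbours on the finer grid. *)
Let truncn_expS (x : R) k : 0 <= x -> exists b : bool,
  Num.truncn (x * 2 ^+ k.+1) = ((Num.truncn (x * 2 ^+ k)).*2 + b)%N.
Proof.
move=> x0; set y := x * 2 ^+ k.
have y0 : 0 <= y by rewrite mulr_ge0 ?exprn_ge0.
have -> : x * 2 ^+ k.+1 = 2 * y by rewrite /y exprS; ring.
have /andP[my ym] := truncn_itv y0; set m := Num.truncn y in my ym *.
have [h|h] := ltP (2 * y) (m.*2.+1)%:R.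
  exists false; apply: truncn_def; rewrite addn0 h andbT.
  by rewrite -mul2n natrM ler_pM2l.
exists true; apply: truncn_def; rewrite addn1 h /=.
by rewrite -doubleS -mul2n natrM ltr_pM2l.
Qed.

Let dyad_step (x : R) k : (n0 <= k.+1)%N -> 0 <= x -> x < 2 ^+ k.+1.+2 ->
  `|p (dyad x k.+1) - p (dyad x k)| <= q ^+ k.+1.
Proof.
move=> nk x0 xk; have [b bE] := truncn_expS _ k x0.
have -> : dyad x k = ((Num.truncn (x * 2 ^+ k)).*2)%:R / 2 ^+ k.+1.
  by rewrite /dyad -mul2n natrM exprS; field; rewrite expf_neq0.
rewrite /dyad bE; case: b bE => bE; last first.
  by rewrite addn0 subrr normr0 exprn_ge0.
rewrite addn1; apply: incr => //.
rewrite -(ltr_nat R); apply: (@le_lt_trans _ _ (x * 2 ^+ k.+1)).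
  apply: le_trans (_ : (Num.truncn (x * 2 ^+ k.+1))%:R <= _).
    by rewrite ler_nat bE leq_addr.
  by rewrite truncn_le mulr_ge0 ?exprn_ge0.
rewrite -[X in (X ^ _)%N]/(2 * 2)%N expnMn natrM !natrX.
have -> : 2 ^+ k.+2 * 2 ^+ k.+2 = 2 ^+ k.+3 * 2 ^+ k.+1 :> R.
  by rewrite !exprS; ring.
by rewrite ltr_pM2r ?exprn_gt0.
Qed.

(** Telescoping; the right side is the sum of q^k for n <= k < n + i, with each step bounded crudely
    by q^(n+i) instead of q^(n+i+1). *)
Let dyad_chain (x : R) n i : (n0 <= n)%N -> 0 <= x -> x < 2 ^+ n.+2 ->
  `|p (dyad x (n + i)) - p (dyad x n)| <= (q ^+ n - q ^+ (n + i)) / (1 - q).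
Proof.
move=> nn x0 xn; elim: i => [|i IH]; first by rewrite addn0 !subrr normr0 mul0r.
have -> : p (dyad x (n + i.+1)) - p (dyad x n) =
  (p (dyad x (n + i.+1)) - p (dyad x (n + i))) + (p (dyad x (n + i)) - p (dyad x n)).
  by ring.
have -> : (q ^+ n - q ^+ (n + i.+1)) / (1 - q) =
   q ^+ (n + i) + (q ^+ n - q ^+ (n + i)) / (1 - q).
  by rewrite addnS exprS; field; apply: lt0r_neq0.
apply: le_trans (ler_normD _ _) _; apply: lerD => //.
rewrite addnS; apply: le_trans (dyad_step _ _ _ x0 _) _.
- by rewrite (leq_trans nn)// -addnS leq_addr.
- by apply: lt_le_trans xn _; rewrite ler_eXn2l ?ltr1n// !ltnS -addnS leq_addr.
- by rewrite exprS ler_piMl ?exprn_ge0// ltW//; case/andP: q01.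
Qed.

Let dyad_lim (x : R) n : (n0 <= n)%N -> 0 <= x -> x < 2 ^+ n.+2 ->
  `|p x - p (dyad x n)| <= q ^+ n / (1 - q).
Proof.
move=> nn x0 xn; apply/ler_addgt0Pl => e e0.
have : `[0, +oo[%classic x by rewrite /= in_itv/= x0.
have /subspace_continuousP/[apply]/cvgrPdist_le/(_ _ e0) := cp.
rewrite near_withinE => /nbhs_ballP[d /= d0 Hd].
have [i id] : exists i, 2^-1 / 2 ^+ i <= d / 2 :> R.
  by apply: half_expn_small; rewrite divr_gt0.
have /andP[dx xd] := dyad_itv _ (n + i) x0.
have dy0 : 0 <= dyad x (n + i) by rewrite divr_ge0.
have : `|p x - p (dyad x (n + i))| <= e.
  apply: (Hd (dyad x (n + i))); last by rewrite /= in_itv/= dy0.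
  rewrite /ball/= ger0_norm ?subr_ge0//.
  have : (2 ^+ (n + i))^-1 <= (2 ^+ i)^-1 :> R.
    by rewrite lef_pV2 ?posrE ?exprn_gt0// ler_eXn2l ?ltr1n// leq_addl.
  lra.
have := dyad_chain _ _ i nn x0 xn.
have : 0 <= q ^+ (n + i) / (1 - q) by rewrite divr_ge0 ?exprn_ge0// ltW.
rewrite mulrBl !ler_norml => *; apply/andP; split; lra.
Qed.

(** As 1/s <= 2^-n, the level-n approximations of s and t coincide or are neighbours: one increment
    of that level plus two chains down to s and t. *)
Lemma dyadic_chaining n (s t : R) : (n0 <= n)%N -> 2 ^+ n <= s < 2 ^+ n.+1 ->
  s <= t <= s + s^-1 -> `|p t - p s| <= (1 + 2 / (1 - q)) * q ^+ n.
Proof.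
move=> nn /andP[ns sn] /andP[st ts].
have s1 : 1 <= s by apply: le_trans ns; rewrite exprn_ege1// ler1n.
have s0 : 0 < s by exact: lt_le_trans s1.
have sV : s^-1 <= (2 ^+ n)^-1 by rewrite lef_pV2 ?posrE ?exprn_gt0.
have sV1 : s^-1 <= 1 by rewrite invf_le1.
have n1 : 1 <= 2 ^+ n :> R by rewrite exprn_ege1// ler1n.
have sn2 : s < 2 ^+ n.+2 by rewrite !exprS in sn *; lra.
have tn2 : t < 2 ^+ n.+2 by rewrite !exprS in sn *; lra.
have t0 := le_trans (ltW s0) st.
have dst : `|p (dyad t n) - p (dyad s n)| <= q ^+ n.
  have st' : (Num.truncn (s * 2 ^+ n) <= Num.truncn (t * 2 ^+ n))%N.
    by apply: le_truncn; rewrite ler_pM2r ?exprn_gt0.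
  have ts' : (Num.truncn (t * 2 ^+ n) <= (Num.truncn (s * 2 ^+ n)).+1)%N.
    rewrite truncn_le_nat -natr1.
    have := truncnS_gt (s * 2 ^+ n).
    have : (t - s) * 2 ^+ n <= 1.
      by rewrite -ler_pdivlMr ?exprn_gt0// div1r; lra.
    lra.
  move: st'; rewrite leq_eqVlt => /predU1P[E|st'].
    by rewrite /dyad E subrr normr0 exprn_ge0.
  have E : Num.truncn (t * 2 ^+ n) = (Num.truncn (s * 2 ^+ n)).+1.
    by apply/eqP; rewrite eqn_leq ts' st'.
  rewrite /dyad E; apply: incr => //.
  rewrite -(ltr_nat R); apply: (@le_lt_trans _ _ (s * 2 ^+ n)).
    by rewrite truncn_le mulr_ge0 ?exprn_ge0// ltW.
  rewrite -[X in (X ^ _)%N]/(2 * 2)%N expnMn natrM !natrX.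
  by apply: ltr_pM; rewrite ?ltW ?exprn_ge0// ?ltr_eXn2l ?ltr1n// ltW.
have := dyad_lim _ _ nn (ltW s0) sn2; have := dyad_lim _ _ nn t0 tn2.
have -> : (1 + 2 / (1 - q)) * q ^+ n = q ^+ n + 2 * (q ^+ n / (1 - q)) by ring.
move: dst; rewrite !ler_norml => *; apply/andP; split; lra.
Qed.
End chaining.

(** * Gaussian tail bound *)

Section gaussian_tail.
Context {R : realType}.

Lemma measurable_norm_gt (l : R) : measurable [set x : R | l < `|x|].
Proof.
rewrite (_ : [set _ | _] = [set: R] `&` @Num.norm R R @^-1` `]l, +oo[%classic).
  exact: normr_measurable.
by rewrite setTI; apply/seteqP; split=> x /=; rewrite in_itv/= andbT.
Qed.

(** The density of variance h is sqrt 2 exp(- x^2 / (4 h)) times that of variance 2 h. On the tail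
    this factor is at most the constant claimed, and the wider density has mass at most 1. *)
Lemma normal_prob_tail (h l : R) : 0 < h -> 0 < l ->
  (normal_prob 0 (Num.sqrt h) [set x : R | (l < `|x|)%R] <=
   (Num.sqrt 2 * expR (- (l ^+ 2 / (4 * h))))%:E)%E.
Proof.
move=> h0 l0.
have sh : Num.sqrt h != 0 by rewrite gt_eqF// sqrtr_gt0.
have h20 : 0 < 2 * h by rewrite mulr_gt0.
have sh2 : Num.sqrt (2 * h) != 0 by rewrite gt_eqF// sqrtr_gt0.
set c := Num.sqrt 2 * _.
have c0 : 0 <= c by rewrite mulr_ge0// expR_ge0.
have mA := measurable_norm_gt l.
apply: (@le_trans _ _ (\int[lebesgue_measure]_(x in [set x : R | (l < `|x|)%R])
    (c%:E * (normal_pdf 0 (Num.sqrt (2 * h)) x)%:E))%E).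
  rewrite /normal_prob; apply: ge0_le_integral => //.
  - by move=> x _; rewrite lee_fin normal_pdf_ge0.
  - by apply/measurable_EFinP; apply: measurable_funTS; exact: measurable_normal_pdf.
  - apply/measurable_EFinP; apply: measurable_funM => //.
    by apply: measurable_funTS; exact: measurable_normal_pdf.
  move=> x /= lx; rewrite -EFinM lee_fin !normal_pdfE//.
  rewrite /normal_peak /normal_fun subr0 (sqr_sqrtr (ltW h0)) (sqr_sqrtr (ltW h20)).
  have -> : 2 * h * pi *+ 2 = 2 * (h * pi *+ 2) by ring.
  rewrite sqrtrM// invfM /c.
  have s20 : Num.sqrt 2 != 0 :> R by rewrite gt_eqF// sqrtr_gt0.
  set P := (Num.sqrt (h * pi *+ 2))^-1.
  have -> : Num.sqrt 2 * expR (- (l ^+ 2 / (4 * h))) *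
      ((Num.sqrt 2)^-1 * P * expR (- x ^+ 2 / (2 * h *+ 2))) =
    P * (expR (- (l ^+ 2 / (4 * h))) * expR (- x ^+ 2 / (2 * h *+ 2))).
    by field.
  apply: ler_wpM2l; first by rewrite invr_ge0.
  rewrite -expRD ler_expR.
  have lx2 : l ^+ 2 <= x ^+ 2.
    by rewrite -(real_normK (num_real x)) ler_sqr ?nnegrE// ltW.
  have -> : - (l ^+ 2 / (4 * h)) + - x ^+ 2 / (2 * h *+ 2) =
     - x ^+ 2 / (h *+ 2) + (x ^+ 2 - l ^+ 2) / (4 * h).
    by field; exact: lt0r_neq0.
  by rewrite lerDl divr_ge0 ?subr_ge0// mulr_ge0// ltW.
have mpdf : measurable_fun [set x : R | l < `|x|]
    (EFin \o normal_pdf 0 (Num.sqrt (2 * h))).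
  by apply/measurable_EFinP; apply: measurable_funTS; exact: measurable_normal_pdf.
have pdf0 (x : R) : [set x : R | l < `|x|] x ->
    (0 <= (EFin \o normal_pdf 0 (Num.sqrt (2 * h))) x)%E.
  by move=> _; rewrite lee_fin normal_pdf_ge0.
have c0E : (0 <= c%:E)%E by rewrite lee_fin.
rewrite (ge0_integralZl lebesgue_measure mA mpdf pdf0 c0E).
apply: (@le_trans _ _ (c%:E * 1)%E); last by rewrite mule1.
apply: lee_pmul => //.
  by apply: integral_ge0 => x _; rewrite lee_fin normal_pdf_ge0.
exact: (@probability_le1 _ _ R (normal_prob 0 (Num.sqrt (2 * h)))).
Qed.
End gaussian_tail.

(** * Almost sure control of dyadic increments *)

Section dyadic_increments.
Context {d : measure_display} {T : measurableType d} {R : realType}.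
Variables (P : probability T R).

(** Use exp y >= y^k / k! with k such that r^k >= 8. The rate 8^-n beats the 4^(n+1) increments of
    level n and leaves a summable 2^-n. *)
Lemma expRN_geometric (r : R) : 1 < r ->
  exists2 M, 0 < M & forall n, expR (- (r ^+ n / 4)) <= M / 8 ^+ n.
Proof.
move=> r1; have r0 : 0 < r by exact: lt_trans r1.
have [k' rk'] := exprn_unbounded r 8 r1; pose k := k'.+1.
have rk : 8 <= r ^+ k by apply: le_trans rk' _; rewrite ler_eXn2l.
pose K : R := 4 ^+ k * k`!%:R.
have K0 : 0 < K by rewrite mulr_gt0 ?exprn_gt0// ltr0n fact_gt0.
exists K => // n; set y := r ^+ n / 4.
have y0 : 0 < y by rewrite divr_gt0// exprn_gt0.
have r8 : 8 ^+ n <= (r ^+ k) ^+ n by rewrite lerXn2r ?nnegrE// exprn_ge0// ltW.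
have yk : 8 ^+ n / K <= expR y.
  apply: le_trans (_ : y ^+ k / k`!%:R <= _); last first.
    by have := @expR_ge1Dxn R y k.-1 (ltW y0); apply: le_trans; rewrite lerDr.
  have -> : y ^+ k / k`!%:R = (r ^+ k) ^+ n / K.
    by rewrite /y /K expr_div_n invfM mulrA exprAC.
  by rewrite ler_wpM2r// invr_ge0 ltW.
rewrite expRN -[leRHS]invrK invf_div lef_pV2 ?posrE ?expR_gt0//.
by rewrite divr_gt0// exprn_gt0.
Qed.

Lemma ae_dyadic_increments (W : R -> {RV P >-> R}) (q : R) :
  (forall (s t : R) (A : set R), 0 <= s -> s < t -> measurable A ->
     P [set w | A (W t w - W s w)] = normal_prob 0 (Num.sqrt (t - s)) A) ->
  0 < q -> 1 < 2 * q ^+ 2 ->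
  {ae P, forall w, exists n0, forall k j, (n0 <= k)%N -> (j < 4 ^ k.+1)%N ->
    `|W (j.+1%:R / 2 ^+ k) w - W (j%:R / 2 ^+ k) w| <= q ^+ k}.
Proof.
move=> gauss q0 q2.
pose B n j := [set w | q ^+ n < `|W (j.+1%:R / 2 ^+ n) w - W (j%:R / 2 ^+ n) w|].
pose A n := \big[setU/set0]_(j < 4 ^ n.+1) B n j.
have mB n j : measurable (B n j).
  rewrite (_ : B n j = setT `&`
      (W (j.+1%:R / 2 ^+ n) \- W (j%:R / 2 ^+ n)) @^-1` [set x : R | q ^+ n < `|x|]).
    have mW : measurable_fun setT (W (j.+1%:R / 2 ^+ n) \- W (j%:R / 2 ^+ n)).
      exact: measurable_funB.
    by apply: mW => //; exact: measurable_norm_gt.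
  by rewrite setTI.
have mA n : measurable (A n) by exact: bigsetU_measurable.
(* For variance 2^-n and threshold q^n the tail exponent is (2 q^2)^n / 4, which grows geometrically
   by [q2]. *)
have [M M0 HM] := expRN_geometric _ q2.
have PB n j : (P (B n j) <= (Num.sqrt 2 * (M / 8 ^+ n))%:E)%E.
  pose h : R := (2 ^+ n)^-1.
  have h0 : 0 < h by rewrite invr_gt0 exprn_gt0.
  have dt : j.+1%:R / 2 ^+ n - j%:R / 2 ^+ n = h.
    by rewrite -mulrBl -natr1 addrAC subrr add0r mul1r.
  rewrite /B (gauss (j%:R / 2 ^+ n) (j.+1%:R / 2 ^+ n) [set x | q ^+ n < `|x|]).
  - rewrite dt; apply: le_trans (normal_prob_tail _ _ h0 _) _.
      by rewrite exprn_gt0.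
    rewrite lee_fin ler_wpM2l//; apply: le_trans (HM n).
    rewrite ler_expR lerN2 le_eqVlt; apply/orP; left; apply/eqP.
    rewrite /h exprMn exprAC -exprM mulnC exprM; field.
    by rewrite expf_neq0.
  - by rewrite divr_ge0.
  - by rewrite -subr_gt0 dt.
  - exact: measurable_norm_gt.
(* A factor 4 comes from the count 4^(n+1), and a factor 2 from writing the bound over 2^(n+1), the
   form of [epsilon_trick0]. *)
pose e := 8 * (Num.sqrt 2 * M).
have PA n : (P (A n) <= (e / (2 ^ n.+1)%:R)%:E)%E.
  apply: le_trans (Boole_inequality _ _) _ => //.
  apply: (@le_trans _ _ (\sum_(i < 4 ^ n.+1) (Num.sqrt 2 * (M / 8 ^+ n))%:E)%E).
    by apply: lee_sum => i _; exact: PB.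
  rewrite sumEFin lee_fin sumr_const card_ord -[leLHS]mulr_natl.
  rewrite le_eqVlt; apply/orP; left; apply/eqP.
  rewrite /e !natrX !exprS.
  have -> : 8 ^+ n = 4 ^+ n * 2 ^+ n :> R by rewrite -exprMn; congr (_ ^+ _); ring.
  by field; rewrite !expf_neq0.
have e0 : 0 <= e by rewrite !mulr_ge0// ltW.
have : P (lim_sup_set A) = 0.
  apply: lim_sup_set_cvg0 => //.
  apply: (@le_lt_trans _ _ e%:E); last exact: ltry.
  apply: le_trans (epsilon_trick0 xpredT e0).
  by apply: lee_nneseries => // n _; exact: PA.
move=> PA0; exists (lim_sup_set A); split => //.
  apply: bigcap_measurable => [|n _]; first by exists 0%N.
  exact: bigcup_measurable.
move=> w /= H n _; apply: contrapT => nA; apply: H; exists n => k j nk jk.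
rewrite leNgt; apply/negP => Bkj; apply: nA; exists k => //.
by rewrite /A -bigcup_mkord; exists j.
Qed.
End dyadic_increments.

(** * The river *)

Section river.
Context {R : realType}.
Variables (sigma : R) (p : R -> R).
Hypothesis cp : {within `[0, +oo[, continuous p}.

(** Starting points up to s - delta s never blow up, which bounds the infimum below; s + delta s
    does blow up, which bounds it above. *)
Lemma river_dist_le (S : R) (delta : R -> R) : 20 <= S ->
  (forall a, S <= a -> 0 < delta a <= 1) ->
  (forall a b, S <= a -> a <= b -> delta b <= delta a) ->
  (forall a b, S <= a -> {within `[a, b], continuous delta}) ->
  (forall a, S <= a -> 4 <= a * delta a) ->
  (forall a r, S <= a -> a <= r <= a + a^-1 ->
    16 * `|sigma * (p r - p a)| <= delta a) ->
  forall s, S <= s -> exists2 x, river sigma p s = x%:E & `|x - s| <= delta s.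
Proof.
move=> S20 delta01 decr cdelta ad4 osc s Ss.
have s0 : 0 <= s by lra.
have lo : ((s - delta s)%:E <= river sigma p s)%E.
  apply: le_ereal_inf_tmp => _ [x /= fin <-]; rewrite lee_fin leNgt.
  apply/negP => /ltW xs; move: fin.
  rewrite (blowup_time_pinfty _ _ cp)//.
  move=> t Y sol.
  exact: (local_solution_below _ _ cp _ _ S20 delta01 decr cdelta osc) Ss xs sol.
have hi : (river sigma p s <= (s + delta s)%:E)%E.
  apply: ereal_inf_lbound; exists (s + delta s) => //=.
  have [T sT nosol] := no_global_solution _ _ cp _ _ S20 delta01 decr osc _ _
    ad4 Ss (lexx _).
  exact: (blowup_time_fin _ _ cp _ _ _ s0 sT nosol).
case: (river sigma p s) lo hi => [x| |]; rewrite ?lee_fin// => lo hi.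
by exists x => //; rewrite ler_distl lerBlDr -lerBlDr lo; lra.
Qed.

Lemma river_asymptotic (alpha : R) : 0 < alpha -> alpha < 2^-1 ->
  (forall e, 0 < e -> exists S, forall a r, S <= a -> a <= r <= a + a^-1 ->
    16 * `|sigma * (p r - p a)| <= e / a `^ alpha) ->
  ((s `^ alpha)%:E * `|river sigma p s - s%:E|)%E @[s --> +oo] --> 0%E.
Proof.
move=> a0 a12 osc.
have key e : 0 < e -> e <= 1 -> exists2 S, 0 < S & forall s, S <= s ->
    exists2 x, river sigma p s = x%:E & `|x - s| <= e / s `^ alpha.
  move=> e0 e1; have [S0 oscS] := osc e e0.
  (* The term 16 / e^2 yields 4 <= a (e / a^alpha): as alpha < 1/2, a^alpha <= sqrt a, and e sqrt a
     >= 4. *)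
  pose S := Num.max S0 (Num.max 20 (16 / e ^+ 2)).
  have SS0 : S0 <= S by rewrite le_max lexx.
  have S20 : 20 <= S by rewrite !le_max lexx !orbT.
  have Se : 16 / e ^+ 2 <= S by rewrite !le_max lexx !orbT.
  have powgt0 a : S <= a -> 0 < a `^ alpha by move=> ?; rewrite powR_gt0//; lra.
  have powge1 a : S <= a -> 1 <= a `^ alpha.
    by move=> ?; rewrite -(powRr0 a); apply: ler_powR; lra.
  exists S; first by lra.
  apply: (river_dist_le S (fun a => e / a `^ alpha)) => //.
  - move=> a Sa; rewrite divr_gt0 ?powgt0//=.
    by rewrite ler_pdivrMr ?powgt0// mul1r (le_trans e1) ?powge1.
  - move=> a b Sa ab; rewrite ler_pM2l// lef_pV2 ?posrE ?powgt0//; last first.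
      exact: le_trans ab.
    by apply: ge0_ler_powR; rewrite ?nnegrE//; lra.
  - move=> a b Sa.
    have cpow : {within `[a, b], continuous (fun x => x `^ alpha)}.
      apply: derivable_within_continuous => x; rewrite in_itv/= => /andP[ax _].
      by apply: derivable_powR; rewrite in_itv/= andbT; lra.
    apply: within_continuousM; first by apply: continuous_subspaceT => ?; exact: cvg_cst.
    apply: within_continuousV => // x; rewrite /= in_itv/= => /andP[ax _].
    by rewrite gt_eqF// powgt0// (le_trans Sa).
  - move=> a Sa; have ga := powgt0 _ Sa; set v := a `^ alpha in ga *.
    have va : v ^+ 2 <= a.
      rewrite /v -powR_mulrn ?powR_ge0// -powRrM.
      by apply: ler1_powR; lra.
    have ae : 16 <= e ^+ 2 * a.
      by move: (le_trans Se Sa); rewrite ler_pdivrMr ?exprn_gt0// mulrC.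
    rewrite mulrA ler_pdivlMr//.
    rewrite -(@ler_sqr _ (4 * v)) ?nnegrE; last 2 first.
    + by rewrite mulr_ge0// ltW.
    + by rewrite mulr_ge0//; lra.
    have : 0 <= (e ^+ 2 * a - 16) * a by rewrite mulr_ge0; lra.
    by rewrite !exprMn; lra.
  - by move=> a r Sa; apply: oscS; exact: le_trans Sa.
apply/fine_cvgP; split.
  have [S S0 HS] := key 1 ltr01 (lexx _).
  near=> s; have /HS[x -> _] : S <= s by near: s; apply: nbhs_pinfty_ge; exact: num_real.
  by [].
apply/cvgrPdist_le => e e0.
(* Capping at 1 keeps the profile at most 1, as the barrier argument requires. *)
pose e' := Num.min e 1.
have e'0 : 0 < e' by rewrite lt_min e0 ltr01.
have [|S S0 HS] := key e' e'0; first by rewrite ge_min lexx orbT.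
near=> s; have Ss : S <= s by near: s; apply: nbhs_pinfty_ge; exact: num_real.
have [x xE xs] := HS s Ss.
have gs : 0 < s `^ alpha by rewrite powR_gt0//; lra.
rewrite /= xE /= sub0r normrN normrM normr_id gtr0_norm// mulrC -ler_pdivlMr//.
by apply: le_trans xs _; rewrite ler_pM2r ?invr_gt0// ge_min lexx.
Unshelve. all: by end_near. Qed.
End river.

(** For 2^n <= a < 2^(n+1), a^alpha is at most A^(n+1) with A = 2^alpha, so a^alpha times the
    oscillation is at most C A (A q)^n, which tends to 0. *)
Lemma dyadic_modulus_osc {R : realType} (sigma alpha q C : R) (p : R -> R) (n0 : nat) :
  0 < alpha -> 0 < q -> 2 `^ alpha * q < 1 -> 0 <= C ->
  (forall n s t, (n0 <= n)%N -> 2 ^+ n <= s < 2 ^+ n.+1 -> s <= t <= s + s^-1 ->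
    `|p t - p s| <= C * q ^+ n) ->
  forall e, 0 < e -> exists S, forall a r, S <= a -> a <= r <= a + a^-1 ->
    16 * `|sigma * (p r - p a)| <= e / a `^ alpha.
Proof.
move=> a0 q0 rho1 C0 mod e e0.
set A := 2 `^ alpha in rho1.
have A0 : 0 < A by rewrite powR_gt0.
have rho0 : 0 < A * q by rewrite mulr_gt0.
have rho01 : 0 < A * q < 1 by rewrite rho0.
pose M := 16 * `|sigma| * C * A.
have M0 : 0 <= M by rewrite !mulr_ge0// ltW.
have [n1 Hn1] := exprn_small _ M e rho01 e0.
exists (2 ^+ maxn n0 n1) => a r Sa ar.
have a1 : 1 <= a by apply: le_trans Sa; rewrite exprn_ege1// ler1n.
have ta0 : (0 < Num.truncn a)%N by rewrite truncn_gt0.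
pose n := trunc_log 2 (Num.truncn a).
have na : 2 ^+ n <= a < 2 ^+ n.+1.
  apply/andP; split.
    apply: le_trans (_ : (Num.truncn a)%:R <= a); last by rewrite truncn_le; lra.
    by rewrite -natrX ler_nat trunc_logP.
  apply: lt_le_trans (truncnS_gt a) _.
  by rewrite -natrX ler_nat trunc_log_ltn.
have nmax : (maxn n0 n1 <= n)%N.
  apply: trunc_log_max => //; rewrite truncn_ge_nat; last by lra.
  by rewrite natrX.
have nn0 : (n0 <= n)%N by apply: leq_trans nmax; exact: leq_maxl.
have nn1 : (n1 <= n)%N by apply: leq_trans nmax; exact: leq_maxr.
have an : a `^ alpha <= A ^+ n.+1.
  rewrite /A -powR_mulrn ?powR_ge0// -powRrM mulrC powRrM powR_mulrn//.
  apply: ge0_ler_powR; rewrite ?nnegrE ?exprn_ge0//; first exact: ltW.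
  - by lra.
  - by case/andP: na => _ /ltW.
have ga : 0 < a `^ alpha by rewrite powR_gt0//; lra.
rewrite ler_pdivlMr//.
apply: le_trans (_ : 16 * (`|sigma| * (C * q ^+ n)) * A ^+ n.+1 <= _).
  apply: ler_pM => //; first exact: ltW.
  by rewrite normrM !ler_wpM2l// mod.
have -> : 16 * (`|sigma| * (C * q ^+ n)) * A ^+ n.+1 = M * (A * q) ^+ n.
  by rewrite /M exprMn exprS; ring.
apply: le_trans Hn1; rewrite ler_wpM2l//.
by rewrite ler_wiXn2l// ltW.
Qed.

Theorem theorem4p9 (d : measure_display) (T : measurableType d) (R : realType)
  (P : probability T R) (W : R -> {RV P >-> R}) (sigma alpha : R) :
  wiener_process W -> 0 < sigma -> 0 < alpha -> alpha < 2^-1 ->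
  {ae P, forall w,
    ((s `^ alpha)%:E * `|river sigma (fun t => W t w) s - s%:E|)%E
      @[s --> +oo] --> 0%E}.
Proof.
move=> [_ cW _ gauss] _ a0 a12.
have pow2_gt1 (x : R) : 0 < x -> 1 < 2 `^ x.
  move=> x0; have : 1 `^ x < 2 `^ x.
    by apply: gt0_ltr_powR; rewrite ?nnegrE// ltr1n.
  by rewrite powR1.
(* With beta strictly between alpha and 1/2 and q = 2^-beta, both 2 q^2 = 2^(1 - 2 beta) > 1 for
   Borel-Cantelli and 2^alpha q = 2^(alpha - beta) < 1 for the decay hold. *)
pose beta := (alpha + 2^-1) / 2.
have b0 : 0 < beta by rewrite /beta; lra.
have ab : 0 < beta - alpha by rewrite /beta; lra.
have b1 : 0 < 1 - beta * 2 by rewrite /beta; lra.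
pose Q := 2 `^ beta; pose q := Q^-1.
have Q1 : 1 < Q by exact: pow2_gt1.
have Q0 : 0 < Q by exact: lt_trans Q1.
have q0 : 0 < q by rewrite invr_gt0.
have q1 : q < 1 by rewrite invf_lt1.
have q2 : 1 < 2 * q ^+ 2.
  rewrite exprVn ltr_pdivlMr ?exprn_gt0// mul1r /Q -powR_mulrn ?powR_ge0//.
  have E2 : 2 `^ (beta * 2) * 2 `^ (1 - beta * 2) = 2 :> R.
    by rewrite -powRD ?pnatr_eq0 ?implybT// addrC subrK powRr1.
  by rewrite -powRrM -[ltRHS]E2 ltr_pMr ?powR_gt0// pow2_gt1.
have aq : 2 `^ alpha * q < 1.
  rewrite ltr_pdivrMr// mul1r /Q.
  have -> : beta = alpha + (beta - alpha) by ring.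
  by rewrite powRD ?pnatr_eq0 ?implybT// ltr_pMr ?powR_gt0// pow2_gt1.
apply: filterS2 (ae_dyadic_increments P W q gauss q0 q2) cW => w [n0 incr] cw.
have q01 : 0 < q < 1 by rewrite q0.
apply: river_asymptotic => //.
apply: (dyadic_modulus_osc sigma alpha q (1 + 2 / (1 - q)) (fun t => W t w) n0) => //.
  by rewrite addr_ge0// divr_ge0// subr_ge0 ltW.
move=> n s t.
exact: (dyadic_chaining (fun t => W t w) q n0 cw q01 incr n s t).
Qed.
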